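(* Let $p$ be an odd prime, $k,m,n\in\mathbb N$ and $b\in\{0,2,4,\ldots\}$. Then $$\left(1-\left(\frac p3\right)p^{k\varphi(p^m)+b}\right)U_{k\varphi(p^m)+b}\equiv\sum_{r=0}^{n-1}(-1)^{n-1-r}\binom{k-1-r}{n-1-r}\binom kr\left(1-\left(\frac p3\right)p^{r\varphi(p^m)+b}\right)U_{r\varphi(p^m)+b}\pmod{p^{mn}}.$$ In particular, for $n=1$ we have $$U_{k\varphi(p^m)+b}\equiv\left(1-\left(\frac p3\right)p^b\right)U_b\pmod{p^m}.$$
   Context: $\mathbb N$ is the set of positive integers; $[x]$ is the greatest integer not exceeding $x$. The sequence $\{U_n\}_{n\ge0}$ is defined by $U_0=1$ and $U_n=-2\sum_{k=1}^{[n/2]}\binom n{2k}U_{n-2k}$ for $n\ge1$. $\varphi$ is Euler's totient function. $\left(\frac p3\right)$ is the Legendre symbol: it equals $0$, $1$, $-1$ according as $p\equiv0,1,2\pmod3$. Binomial coefficients with possibly negative upper entry are $\binom xj=x(x-1)\cdots(x-j+1)/j!$ for integers $j\ge0$. *)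

(* Defs.v *)
From HB Require Import structures.
From mathcomp Require Import all_boot all_order all_algebra.

Set Implicit Arguments.
Unset Strict Implicit.
Unset Printing Implicit Defensive.

Import Order.TTheory GRing.Theory Num.Theory.
Local Open Scope ring_scope.

(* [U_prefix n] is [:: U_0; ...; U_n]; the recurrence refers to all earlier
   values, so the sequence is built by accumulating them. *)
Fixpoint U_prefix (n : nat) : seq int :=
  if n is n'.+1 then
    let s := U_prefix n' in
    rcons s (- 2 * \sum_(1 <= k < n./2.+1) 'C(n, 2 * k)%:Z * s`_(n - 2 * k))
  else [:: 1].

Definition U (n : nat) : int := (U_prefix n)`_n.

Lemma size_U_prefix n : size (U_prefix n) = n.+1.
Proof. by elim: n => [//|n IHn]; rewrite /= size_rcons IHn. Qed.

Lemma nth_U_prefix n i : (i <= n)%N -> (U_prefix n)`_i = U i.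
Proof.
elim: n => [|n IHn]; first by rewrite leqn0 => /eqP ->.
rewrite leq_eqVlt => /orP[/eqP -> //|lt_in].
by rewrite [U_prefix n.+1]/= nth_rcons size_U_prefix lt_in IHn.
Qed.

Lemma U0 : U 0 = 1.
Proof. by []. Qed.

Lemma U_rec n : (0 < n)%N ->
  U n = - 2 * \sum_(1 <= k < n./2.+1) 'C(n, 2 * k)%:Z * U (n - 2 * k).
Proof.
case: n => [//|n] _.
rewrite {1}/U [U_prefix n.+1]/= nth_rcons size_U_prefix ltnn eqxx.
congr (_ * _); apply: eq_big_nat => -[//|k] _.
by rewrite nth_U_prefix // mulnS subSS leq_subr.
Qed.

(* The Legendre symbol (a / 3). *)
Definition legendre3 (a : nat) : int :=
  if (a %% 3 == 0)%N then 0 else if (a %% 3 == 1)%N then 1 else -1.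

(* x (x - 1) ... (x - j + 1) / j!, for a possibly negative x; the division is
   exact by [binzM_fact]. *)
Definition binz (x : int) (j : nat) : int :=
  ((\prod_(i < j) (x - i%:Z)) %/ j`!%:Z)%Z.

Lemma binz_prod_nat (x j : nat) :
  \prod_(i < j) (x%:Z - i%:Z) = ('C(x, j) * j`!)%N%:Z.
Proof.
rewrite bin_ffact; elim: j => [|j IHj]; first by rewrite big_ord0 ffactn0.
rewrite big_ord_recr /= IHj ffactnSr PoszM.
case: (leqP j x) => [le_jx|lt_xj]; first by rewrite subzn.
by rewrite ffact_small // !mul0r.
Qed.

Lemma binz_prod_neg (x j : nat) :
  \prod_(i < j) (- x.+1%:Z - i%:Z) = (-1) ^+ j * ('C(x + j, j) * j`!)%N%:Z.
Proof.
rewrite bin_ffact; elim: j => [|j IHj]; first by rewrite big_ord0 ffactn0.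
rewrite big_ord_recr /= IHj addnS ffactSS PoszM exprS.
have -> : - x.+1%:Z - j%:Z = - (x + j).+1%:Z by rewrite -opprD -PoszD addSn.
by rewrite mulN1r mulrN !mulNr -mulrA [_%:Z * _]mulrC.
Qed.

Lemma binzM_fact (x : int) (j : nat) :
  binz x j * j`!%:Z = \prod_(i < j) (x - i%:Z).
Proof.
apply: divzK; case: x => x; first by rewrite binz_prod_nat PoszM dvdz_mull.
by rewrite NegzE binz_prod_neg PoszM mulrA dvdz_mull.
Qed.

Lemma binz_nat (x j : nat) : binz x j = 'C(x, j).
Proof. by rewrite /binz binz_prod_nat PoszM mulzK // eqz_nat -lt0n fact_gt0. Qed.

(* Main.v *)
Require Import Defs.
From HB Require Import structures.
From mathcomp Require Import all_boot all_order all_algebra.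
From mathcomp Require Import cyclic zify ring.

Set Implicit Arguments.
Unset Strict Implicit.
Unset Printing Implicit Defensive.

Import Order.TTheory GRing.Theory Num.Theory.
Local Open Scope ring_scope.

(* Let [a_j] be the 6-periodic sequence 0, 1, 1, 0, -1, -1 with generating
   function [x / (1 - x + x^2)], so that formally [U_n] is the Abel sum of
   [a_j j^n].  Umbrally, writing [E_n(y)] for [(U + y)^n], the recurrence says
   [E_n(y + 1) - E_n(y) + E_n(y - 1) = y^n], and summation by parts gives
   [sum_(j <= 3N) a_j j^n = E_n(3N) + U_n = 2 U_n (mod N)] for odd [N].  As
   [a_(p j) = (p/3) a_j], dropping the multiples of [p] from the sum yields
   [2 (1 - (p/3) p^n) U_n] modulo any power of [p].  With [n = r phi(p^m) + b],
   both sides of the congruence are then combinations, over [j] prime to [p],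
   of powers of [x = j^phi(p^m)], and their difference is divisible by
   [(x - 1)^n] because the right-hand side becomes the truncation at order [n]
   of the expansion of [x^k] at [x = 1]. *)

(** Serves with [d = 2] for the even indices in the recurrence and with [d = p] for the multiples of
    [p]. *)
Lemma big_nat_dvdn (R : nmodType) (d N : nat) (F : nat -> R) : (0 < d)%N ->
  \sum_(0 <= j < N.+1 | (d %| j)%N) F j
    = \sum_(0 <= i < (N %/ d).+1) F (d * i)%N.
Proof.
move=> d_gt0; elim: N => [|N IHN].
  by rewrite div0n big_mkcond /= !big_nat1 dvdn0 muln0.
rewrite big_mkcond big_nat_recr //= -big_mkcond IHN divnS //.
case: (boolP (d %| N.+1)%N) => [dN|_]; last by rewrite addr0 add0n.
rewrite add1n [RHS]big_nat_recr //=; congr (_ + F _).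
by have := divnS N d_gt0; rewrite dN add1n => <-; rewrite mulnC divnK.
Qed.

Lemma PoszX (a e : nat) : (a ^ e)%N%:Z = a%:Z ^+ e.
Proof. by rewrite -natz natrX natz. Qed.

(** * Umbral calculus for [U] *)

Definition umbral (q : {poly int}) : int := \sum_(i < size q) q`_i * U i.

Lemma umbralE (q : {poly int}) (N : nat) : (size q <= N)%N ->
  umbral q = \sum_(i < N) q`_i * U i.
Proof.
move=> le_qN; rewrite /umbral (big_ord_widen N (fun i => q`_i * U i)) //.
rewrite [LHS]big_mkcond /=; apply: eq_bigr => i _; case: ltnP => // le_qi.
by rewrite nth_default // mul0r.
Qed.

Lemma umbral_linear : linear_for *%R umbral.
Proof.
move=> c q1 q2; pose N := maxn (size q1) (size q2).
have le1 : (size q1 <= N)%N by rewrite leq_maxl.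
have le2 : (size q2 <= N)%N by rewrite leq_maxr.
have le12 : (size (c *: q1 + q2)%R <= N)%N.
  rewrite (leq_trans (size_polyD _ _)) // geq_max le2 andbT.
  exact: leq_trans (size_scale_leq _ _) le1.
rewrite (umbralE le1) (umbralE le2) (umbralE le12) big_distrr -big_split /=.
by apply: eq_bigr => i _; rewrite coefD coefZ mulrDl mulrA.
Qed.

HB.instance Definition _ :=
  GRing.isLinear.Build int {poly int} int *%R umbral umbral_linear.

Lemma umbralXn n : umbral 'X^n = U n.
Proof.
rewrite (umbralE (N := n.+1)) ?size_polyXn // (bigD1 ord_max) //= coefXn eqxx.
rewrite mul1r big1 ?addr0 // => i; rewrite -val_eqE /= => /negPf ne_in.
by rewrite coefXn ne_in mul0r.
Qed.

(** Odd powers of [1] and [-1] cancel and even ones double; for [n > 0] the recurrence says that the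
    doubled terms other than [2 * U n] add up to [- U n]. *)
Lemma umbral_three_term n :
  umbral (('X + 1) ^+ n) + umbral (('X - 1) ^+ n) - umbral 'X^n = (n == 0)%:R.
Proof.
case: n => [|n]; first by rewrite !expr0 -(expr0 'X) umbralXn.
have pair_terms (i : 'I_n.+2) :
    umbral ('X ^+ (n.+1 - i) * 1 ^+ i *+ 'C(n.+1, i))
      + umbral ('X ^+ (n.+1 - i) * (-1) ^+ i *+ 'C(n.+1, i))
    = if (2 %| i)%N then 2 * ('C(n.+1, i)%:Z * U (n.+1 - i)) else 0.
  rewrite -raddfD /= expr1n -signr_odd dvdn2 -mulrnDl raddfMn /= mulr1.
  case: (odd i); first by rewrite /= expr1 mulrN1 subrr raddf0 mul0rn.
  rewrite /= expr0 mulr1 raddfD /= umbralXn -mulr_natl natz.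
  by ring.
rewrite !exprDn !linear_sum -big_split /= (eq_bigr _ (fun i _ => pair_terms i)).
rewrite -big_mkcond -(big_mkord (fun i => (2 %| i)%N)
  (fun i => 2 * ('C(n.+1, i)%:Z * U (n.+1 - i)))) big_nat_dvdn //.
rewrite divn2 big_nat_recl // muln0 bin0 subn0 umbralXn [U n.+1]U_rec //.
by rewrite big_add1 -!mulr_sumr; ring.
Qed.

Definition appell (n : nat) (y : int) : int := umbral (('X + y%:P) ^+ n).

Lemma appell_three_term n y :
  appell n (y + 1) + appell n (y - 1) - appell n y = y ^+ n.
Proof.
have expand (z : {poly int}) : umbral ((z + y%:P) ^+ n)
    = \sum_(i < n.+1) y ^+ i * 'C(n, i)%:Z * umbral (z ^+ (n - i)).
  rewrite exprDn linear_sum; apply: eq_bigr => i _.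
  rewrite -polyC_exp mulrC mul_polyC raddfMn /= linearZ /= -mulr_natl natz.
  by rewrite mulrA [_%:Z * _]mulrC.
(* Regroup the bases as [z + y%:P] with [z] equal to ['X + 1], ['X - 1] and ['X]; after expansion
   only the term [i = n] survives. *)
rewrite /appell !polyCD polyCN !addrA ![_ + y%:P]addrC -!addrA ![y%:P + _]addrC.
rewrite !expand -!sumrN -!big_split /=.
rewrite (eq_bigr (fun i : 'I_n.+1 => y ^+ i * 'C(n, i)%:Z * (n - i == 0)%N%:R)).
  rewrite big_ord_recr /= subnn eqxx binn !mulr1 big1 ?add0r // => i _.
  by rewrite subn_eq0 leqNgt ltn_ord mulr0.
by move=> i _; rewrite -umbral_three_term; ring.
Qed.

Lemma appell_dvd n y : (y %| appell n y - U n)%Z.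
Proof.
rewrite /appell exprDn linear_sum big_ord_recl /= subn0 bin0 expr0 mulr1 mulr1n.
rewrite umbralXn addrC addKr; elim/big_ind: _ => // [|i _].
  by move=> u v; apply: rpredD.
rewrite -polyC_exp mulrC mul_polyC raddfMn /= linearZ /= exprS.
by rewrite -mulr_natl dvdz_mull // -mulrA dvdz_mulr.
Qed.

(** * The 6-periodic sequence and its power sums *)

Definition hex (j : nat) : int := [:: 0; 1; 1; 0; -1; -1]`_(j %% 6).

Lemma hex_three_term j : hex j.+2 = hex j.+1 - hex j.
Proof.
rewrite /hex -[j.+2]addn2 -[j.+1]addn1 -(modnDml j 1) -(modnDml j 2).
by have := ltn_pmod j (isT : 0 < 6)%N; case: (j %% 6)%N => [|[|[|[|[|[|]]]]]].
Qed.

(** An odd [p] is 1, 3 or 5 modulo 6, and multiplying the index by these fixes, annihilates or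
    negates the sequence. *)
Lemma hexM p i : odd p -> hex (p * i) = legendre3 p * hex i.
Proof.
move=> p_odd; have: odd (p %% 6) by rewrite odd_mod.
rewrite /hex /legendre3 -(modn_dvdm p (isT : 3 %| 6)%N) -modnMm.
have := ltn_pmod p (isT : 0 < 6)%N; have := ltn_pmod i (isT : 0 < 6)%N.
by case: (p %% 6)%N => [|[|[|[|[|[|]]]]]] //; case: (i %% 6)%N => [|[|[|[|[|[|]]]]]].
Qed.

Lemma hex_power_sum n J :
  \sum_(0 <= j < J.+1) hex j * j%:Z ^+ n
    = hex J * appell n (J%:Z + 1) - hex J.+1 * appell n J%:Z + U n.
Proof.
elim: J => [|J IHJ].
  rewrite big_nat1 /hex /= !mul0r mul1r sub0r /appell addr0 umbralXn addNr //.
rewrite big_nat_recr //= IHJ hex_three_term -(appell_three_term n J.+1).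
have -> : J.+1%:Z - 1 = J%:Z by rewrite -addn1 PoszD addrK.
have -> : J%:Z + 1 = J.+1%:Z by rewrite -addn1 PoszD.
by ring.
Qed.

Lemma hex_power_sum_dvd n N : odd N ->
  (N%:Z %| \sum_(0 <= j < (3 * N).+1) hex j * j%:Z ^+ n - 2 * U n)%Z.
Proof.
(* Oddness of [N] puts [3 * N] at a zero of [hex], followed by the value -1, so a single boundary
   term remains. *)
move=> N_odd; have N6 : (3 * N %% 6 = 3)%N by lia.
have N6' : ((3 * N).+1 %% 6 = 4)%N by lia.
rewrite hex_power_sum /hex N6 N6' /= mul0r sub0r mulN1r opprK.
have -> : appell n (3 * N)%N + U n - 2 * U n = appell n (3 * N)%N - U n by ring.
by apply: dvdz_trans (appell_dvd n _); rewrite PoszM dvdz_mull.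
Qed.

(* Summing up to [3 p^(M+1)] makes the sum over multiples of [p] one up to
   [3 p^M], which costs one power of [p] in the modulus. *)
Lemma prime_to_p_power_sum p M n : odd p -> prime p ->
  (p%:Z ^+ M %| \sum_(0 <= j < (3 * p ^ M.+1).+1 | ~~ (p %| j)%N) hex j * j%:Z ^+ n
     - 2 * ((1 - legendre3 p * p%:Z ^+ n) * U n))%Z.
Proof.
move=> p_odd p_pr; have p_gt0 := prime_gt0 p_pr.
have oddX e : odd (p ^ e) by rewrite oddX p_odd orbT.
have multiples : \sum_(0 <= j < (3 * p ^ M.+1).+1 | (p %| j)%N) hex j * j%:Z ^+ n
    = legendre3 p * p%:Z ^+ n
      * \sum_(0 <= i < (3 * p ^ M).+1) hex i * i%:Z ^+ n.
  rewrite big_nat_dvdn // expnSr mulnA mulnK // mulr_sumr.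
  by apply: eq_bigr => i _; rewrite hexM // PoszM exprMn mulrACA.
have dvdT : (p%:Z ^+ M %| (p ^ M.+1)%N%:Z)%Z by rewrite expnSr PoszM PoszX dvdz_mulr.
have := dvdz_trans dvdT (hex_power_sum_dvd n (oddX M.+1)).
have := hex_power_sum_dvd n (oddX M); rewrite PoszX.
move=> /(dvdz_mull (legendre3 p * p%:Z ^+ n)) dvdS.
rewrite (bigID (fun j => p %| j)%N) /= multiples -(rpredBr _ dvdS).
by congr (_ %| _)%Z; ring.
Qed.

(** * Truncating the expansion of [x ^+ k] at 1 *)

(** Both sides are the multinomial coefficient [k! / (r! (n - r)! (k - n)!)]. *)
Lemma bin_bin (k n r : nat) : (r <= n <= k)%N ->
  ('C(k, r) * 'C(k - r, n - r) = 'C(k, n) * 'C(n, r))%N.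
Proof.
case/andP=> le_rn le_nk; have le_rk := leq_trans le_rn le_nk.
have F_gt0 : (0 < r`! * (n - r)`! * (k - n)`!)%N by rewrite !muln_gt0 !fact_gt0.
apply/eqP; rewrite -(eqn_pmul2r F_gt0); apply/eqP; transitivity k`!.
  rewrite -(bin_fact le_rk) -(bin_fact (leq_sub2r r le_nk)).
  have -> : (k - r - (n - r) = k - n)%N by lia.
  by nia.
by rewrite -(bin_fact le_nk) -(bin_fact le_rn); nia.
Qed.

Lemma truncated_binomial (k n : nat) (x : int) : (n <= k)%N ->
  \sum_(0 <= r < n)
      (-1) ^+ (n - 1 - r) * 'C(k - 1 - r, n - 1 - r)%:Z * 'C(k, r)%:Z * x ^+ r
  = \sum_(0 <= s < n) 'C(k, s)%:Z * (x - 1) ^+ s.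
Proof.
elim: n => [|n IHn] lt_nk; first by rewrite !big_geq.
rewrite [RHS]big_nat_recr //= -IHn ?(ltnW lt_nk) // big_nat_recr //=.
rewrite subn1 subnn bin0 expr0 !mul1r [x - 1]addrC exprDn.
rewrite -(big_mkord xpredT
  (fun i => (-1) ^+ (n - i) * x ^+ i *+ 'C(n, i))).
rewrite big_nat_recr //= subnn binn mulr1n expr0 mul1r mulrDr addrA.
congr (_ + _).
rewrite mulr_sumr addrC -big_split /=; apply: eq_big_nat => r /andP[_ lt_rn].
have := bin_bin (k := k) (n := n) (r := r); rewrite (ltnW lt_rn) (ltnW lt_nk) => /(_ isT).
have -> : (k - r = (k - 1 - r).+1)%N by lia.
have -> : (n - r = (n - 1 - r).+1)%N by lia.
(* Pascal's rule on ['C(k - r, n - r)] matches the old and new coefficients of [x ^+ r]. *)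
rewrite binS => /(congr1 Posz); rewrite !PoszM PoszD exprS mulN1r -mulr_natr natz.
set u := (-1) ^+ _ => E.
transitivity (- u * x ^+ r * ('C(k, n)%:Z * 'C(n, r)%:Z)
    + u * 'C(k - 1 - r, n - 1 - r)%:Z * 'C(k, r)%:Z * x ^+ r); last by ring.
by rewrite -E; ring.
Qed.

Lemma binzN1 j : binz (-1) j = (-1) ^+ j.
Proof.
have fact_neq0 : j`!%:Z != 0 by rewrite eqz_nat -lt0n fact_gt0.
by apply: (mulIf fact_neq0); rewrite binzM_fact (binz_prod_neg 0) add0n binn mul1n.
Qed.

Lemma interpolation_dvd (k n : nat) (x : int) : (0 < k)%N ->
  ((x - 1) ^+ n %| x ^+ k - \sum_(0 <= r < n)
     (-1) ^+ (n - 1 - r) * binz (k%:Z - 1 - r%:Z) (n - 1 - r) * 'C(k, r)%:Z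
       * x ^+ r)%Z.
Proof.
move=> k_gt0; have binz_sub r : (r < k)%N ->
    binz (k%:Z - 1 - r%:Z) (n - 1 - r) = 'C(k - 1 - r, n - 1 - r).
  by move=> lt_rk; rewrite -binz_nat; congr (binz _ _); lia.
case: (leqP n k) => [le_nk | lt_kn].
  have -> : x ^+ k = \sum_(0 <= s < k.+1) 'C(k, s)%:Z * (x - 1) ^+ s.
    rewrite -{1}(subrK 1 x) addrC exprDn big_mkord; apply: eq_bigr => i _.
    by rewrite expr1n mul1r -mulr_natl natz.
  rewrite [X in _ - X](eq_big_nat _ _ (F2 := fun r => (-1) ^+ (n - 1 - r)
    * 'C(k - 1 - r, n - 1 - r)%:Z * 'C(k, r)%:Z * x ^+ r)); last first.
    by move=> r /andP[_ lt_rn]; rewrite binz_sub ?(leq_trans lt_rn).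
  (* What remains is the tail [s >= n], each term of which contains [(x - 1) ^+ n]. *)
  rewrite truncated_binomial // (big_cat_nat (n := n)) ?leqW //= addrAC subrr add0r.
  rewrite big_nat; apply: rpred_sum => s /andP[le_ns _].
  by rewrite -(subnK le_ns) exprD mulrA dvdz_mull.
(* For [k < n] the difference is 0: only [r = k] survives, where [binz (-1)] cancels the sign. *)
rewrite (big_cat_nat (n := k)) ?(ltnW lt_kn) //= big_nat big1 => [|r /= lt_rk].
  rewrite add0r big_ltn // big_nat big1 => [|r /andP[lt_kr _]]; last first.
    by rewrite bin_small // mulr0 mul0r.
  have -> : k%:Z - 1 - k%:Z = -1 by ring.
  by rewrite binzN1 -expr2 sqrr_sign binn !mul1r addr0 subrr dvdz0.
by rewrite binz_sub // bin_small ?mulr0 ?mul0r //; lia.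
Qed.

(** * Euler's theorem and the congruences *)

Lemma euler_dvdz (p m j : nat) : prime p -> ~~ (p %| j)%N ->
  (p%:Z ^+ m %| j%:Z ^+ totient (p ^ m) - 1)%Z.
Proof.
move=> p_pr p_ndvd_j; rewrite -eqz_mod_dvd -!PoszX !modz_nat eqz_nat.
by apply/eqP/Euler_exp_totient; rewrite coprimeXr // coprime_sym prime_coprime.
Qed.

(** Ensures that the power of [p] on the left-hand side vanishes modulo [p ^ m] when [n = 1]. *)
Lemma leq_totient_pexp p m : prime p -> odd p -> (m <= totient (p ^ m))%N.
Proof.
case: m => [//|m] p_pr p_odd; have p_gt2 := odd_prime_gt2 p_odd p_pr.
rewrite totient_pfactor //=; apply: leq_trans (_ : p ^ m <= _)%N.
  by rewrite ltn_expl // prime_gt1.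
by rewrite leq_pmull //; lia.
Qed.

Theorem theorem4p3 (p k m b : nat) (p_prime : prime p) (p_odd : odd p)
  (k_gt0 : (0 < k)%N) (m_gt0 : (0 < m)%N) (b_even : ~~ odd b) :
  (forall n : nat, (0 < n)%N ->
    ((1 - legendre3 p * p%:Z ^+ (k * totient (p ^ m) + b))
       * U (k * totient (p ^ m) + b)
     = \sum_(0 <= r < n)
         (-1) ^+ (n - 1 - r) * binz (k%:Z - 1 - r%:Z) (n - 1 - r)
         * 'C(k, r)%:Z
         * ((1 - legendre3 p * p%:Z ^+ (r * totient (p ^ m) + b))
            * U (r * totient (p ^ m) + b))
       %[mod p%:Z ^+ (m * n)])%Z)
  /\
  (U (k * totient (p ^ m) + b) = (1 - legendre3 p * p%:Z ^+ b) * U b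
     %[mod p%:Z ^+ m])%Z.
Proof.
set q := totient (p ^ m).
have main n : (0 < n)%N ->
    ((1 - legendre3 p * p%:Z ^+ (k * q + b)) * U (k * q + b)
     = \sum_(0 <= r < n)
         (-1) ^+ (n - 1 - r) * binz (k%:Z - 1 - r%:Z) (n - 1 - r)
         * 'C(k, r)%:Z
         * ((1 - legendre3 p * p%:Z ^+ (r * q + b)) * U (r * q + b))
       %[mod p%:Z ^+ (m * n)])%Z.
  move=> n_gt0; set M := (m * n)%N.
  pose c r := (-1) ^+ (n - 1 - r) * binz (k%:Z - 1 - r%:Z) (n - 1 - r)
    * 'C(k, r)%:Z.
  pose f r := (1 - legendre3 p * p%:Z ^+ (r * q + b)) * U (r * q + b).
  (* The range of [j] is the same for all [r], so the sums combine termwise. *)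
  pose S r := \sum_(0 <= j < (3 * p ^ M.+1).+1 | ~~ (p %| j)%N)
    hex j * j%:Z ^+ (r * q + b).
  have dvdSf r : (p%:Z ^+ M %| S r - 2 * f r)%Z by apply: prime_to_p_power_sum.
  have dvdS : (p%:Z ^+ M %| S k - \sum_(0 <= r < n) c r * S r)%Z.
    under eq_bigr do rewrite mulr_sumr.
    rewrite exchange_big /= -sumrB; apply: rpred_sum => j p_ndvd_j.
    have -> : hex j * j%:Z ^+ (k * q + b)
        - \sum_(0 <= r < n) c r * (hex j * j%:Z ^+ (r * q + b))
      = hex j * j%:Z ^+ b * ((j%:Z ^+ q) ^+ k
          - \sum_(0 <= r < n) c r * (j%:Z ^+ q) ^+ r).
      rewrite mulrBr mulr_sumr -exprM [(q * k)%N]mulnC exprD; congr (_ - _).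
        by ring.
      by apply: eq_bigr => r _; rewrite -exprM [(q * r)%N]mulnC exprD; ring.
    (* Interpolation at [x = j ^ q] gives the factor [(x - 1) ^+ n], and [p ^ m] divides [x - 1] by
       Euler. *)
    rewrite dvdz_mull //; apply: dvdz_trans (interpolation_dvd _ _ k_gt0).
    by rewrite /M exprM dvdz_exp2r // euler_dvdz.
  apply/eqP; rewrite eqz_mod_dvd -/(f k).
  (* The power sums only control [2 * f r]; as [p] is odd, the 2 can be cancelled. *)
  have coprime2 : coprimez (p%:Z ^+ M) 2.
    by rewrite coprimezXl // coprimezE /= coprimen2.
  rewrite -(Gauss_dvdzr _ coprime2).
  have -> : 2 * (f k - \sum_(0 <= r < n) c r * f r)
      = S k - \sum_(0 <= r < n) c r * S r
        - (S k - 2 * f k - \sum_(0 <= r < n) c r * (S r - 2 * f r)).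
    under [X in _ - (_ - X)]eq_bigr do rewrite mulrBr mulrCA.
    by rewrite sumrB -mulr_sumr; ring.
  apply: rpredB => //; apply: rpredB => //.
  by apply: rpred_sum => r _; apply: dvdz_mull.
split=> //; have := main 1%N isT.
have binz0 x : binz x 0 = 1 by rewrite /binz big_ord0.
rewrite big_nat1 muln1 subnn expr0 binz0 bin0 mul0n add0n !mul1r => <-.
apply/eqP; rewrite eqz_mod_dvd mulrBl mul1r opprB addrCA subrr addr0.
rewrite -mulrA dvdz_mull // dvdz_mulr // dvdz_exp2l //.
apply: leq_trans (leq_totient_pexp m p_prime p_odd) _.
exact: leq_trans (leq_pmull _ k_gt0) (leq_addr _ _).
Qed.
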